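(* Let $\mathbb F$ be a field with $|\mathbb F| > k \ge 4$, let $n \ge k+2$ with $n+k$ odd, and let $T\colon \mathrm{M}_{n\,k}(\mathbb F) \to \mathrm{M}_{n\,k}(\mathbb F)$ be a linear map. Then $\det_{n\,k}(T(X)) = \det_{n\,k}(X)$ for all $X \in \mathrm{M}_{n\,k}(\mathbb F)$ if and only if there exist $A \in \mathrm{M}_{n\,n}(\mathbb F)$ and $B \in \mathrm{M}_{k\,k}(\mathbb F)$ such that \[ \det_{n\,k}\bigl(A(|i_1,\ldots,i_k]\bigr)\,\det_k(B) = (-1)^{i_1+\cdots+i_k-1-\cdots-k} \] for all increasing sequences $1 \le i_1 < \cdots < i_k \le n$, and a linear map $\phi\colon \mathrm{M}_{n\,k}(\mathbb F) \to W_{n\,k}$ such that \[ T(X) = AXB + \phi(X) \quad \text{for all } X \in \mathrm{M}_{n\,k}(\mathbb F). \]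
   Context: $\mathrm{M}_{n\,k}(\mathbb F)$ denotes the space of $n\times k$ matrices over $\mathbb F$; $x_{i\,j}$ is the $(i,j)$ entry of $X$. The condition $|\mathbb F|>k$ means that $\mathbb F$ is infinite or finite with more than $k$ elements. For $n \ge k$ and $X=(x_{i\,j}) \in \mathrm{M}_{n\,k}(\mathbb F)$, the Cullis determinant is $\det_{n\,k}(X) = \sum_{\sigma} \operatorname{sgn}_{n\,k}(\sigma)\, x_{\sigma(1)\,1}\cdots x_{\sigma(k)\,k}$, the sum over all injections $\sigma\colon\{1,\ldots,k\}\to\{1,\ldots,n\}$, where, writing $\sigma(\{1,\dots,k\}) = \{i_1<\cdots<i_k\}$, $\operatorname{sgn}_{n\,k}(\sigma) = \operatorname{sgn}(\pi_\sigma)\cdot(-1)^{\sum_{\alpha=1}^k (i_\alpha-\alpha)}$ and $\pi_\sigma$ is the permutation of $\{i_1,\dots,i_k\}$ sending $i_\alpha$ to $\sigma(\alpha)$. For $n=k$, $\det_{k}=\det_{k\,k}$ is the ordinary determinant. For $A \in \mathrm{M}_{n\,n}(\mathbb F)$, $A(|i_1,\ldots,i_k]$ denotes the $n\times k$ submatrix of $A$ formed by the columns with indices $i_1,\ldots,i_k$. $W_{n\,k}\subseteq \mathrm{M}_{n\,k}(\mathbb F)$ is the $k$-dimensional subspace of matrices all of whose rows are equal. *)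

(* Defs.v *)
From HB Require Import structures.
From mathcomp Require Import all_boot all_order all_fingroup all_algebra.
Set Implicit Arguments.
Unset Strict Implicit.
Unset Printing Implicit Defensive.
Import GRing.Theory.
Local Open Scope ring_scope.

(* |F| > k, for F infinite or finite; [Finite.axiom e] says that e lists every
   element of F exactly once. *)
Definition card_field_gt (F : fieldType) (k : nat) : Prop :=
  ~ (exists e : seq F, Finite.axiom e) \/
  (exists e : seq F, Finite.axiom e /\ (k < size e)%N).

Section Injections.
Variables k n : nat.

Definition injection := {s : {ffun 'I_k -> 'I_n} | injectiveb s}.

Implicit Types (s : injection) (a : 'I_k) (x : 'I_n).

Definition inj_image s : {set 'I_n} := [set val s a | a : 'I_k].

(* i_a, where s({1..k}) = {i_1 < ... < i_k}. The enumeration of a set of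
   ordinals is increasing and has length k here, so that the default value of
   [nth] is never used. *)
Definition inj_index s a : 'I_n := nth (val s a) (enum (inj_image s)) a.

Lemma injection_inj s : injective (val s).
Proof. exact/injectiveP/(valP s). Qed.

Lemma card_inj_image s : #|inj_image s| = k.
Proof. by rewrite card_imset ?card_ord //; exact: injection_inj. Qed.

Lemma size_inj_image s : size (enum (inj_image s)) = k.
Proof. by rewrite -cardE card_inj_image. Qed.

Lemma inj_indexE s x0 a : inj_index s a = nth x0 (enum (inj_image s)) a.
Proof. by apply: set_nth_default; rewrite size_inj_image. Qed.

Lemma inj_index_in s a : inj_index s a \in inj_image s.
Proof. by rewrite -mem_enum mem_nth // size_inj_image. Qed.

Lemma inj_index_onto s x : x \in inj_image s -> exists a, inj_index s a = x.
Proof.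
rewrite -mem_enum => xs; have lt_k : (index x (enum (inj_image s)) < k)%N.
  by rewrite -[X in (_ < X)%N](size_inj_image s) index_mem.
by exists (Ordinal lt_k); rewrite (inj_indexE s x) nth_index.
Qed.

Lemma inj_index_inj s : injective (inj_index s).
Proof.
move=> a b; rewrite (inj_indexE s (val s a) b) /inj_index => /eqP.
by rewrite nth_uniq ?size_inj_image ?enum_uniq // => /eqP/val_inj.
Qed.

Lemma inj_index_mono s (a b : 'I_k) :
  (a < b)%N -> (inj_index s a < inj_index s b)%N.
Proof.
move=> ltab; rewrite (inj_indexE s (val s a) b) /inj_index.
have srt : sorted (fun x y : 'I_n => (x < y)%N) (enum (inj_image s)).
  rewrite /enum_mem -enumT; apply: sorted_filter.
    by move=> x y z; apply: ltn_trans.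
  by have := iota_ltn_sorted 0 n; rewrite -val_enum_ord sorted_map.
apply: (sorted_ltn_nth _ _ srt) => //; rewrite ?inE ?size_inj_image //.
by move=> x y z; apply: ltn_trans.
Qed.

Definition inj_perm_fun s x : 'I_n :=
  if [pick a | inj_index s a == x] is Some a then val s a else x.

Lemma inj_perm_fun_inj s : injective (inj_perm_fun s).
Proof.
move=> x y; rewrite /inj_perm_fun.
have out z b : (fun a => inj_index s a == z) =1 xpred0 -> val s b <> z.
  move=> no_a sbz; have /inj_index_onto[a /eqP az] : z \in inj_image s.
    by rewrite -sbz imset_f.
  by have := no_a a; rewrite az.
case: pickP => [a /eqP <-|no_x]; case: pickP => [b /eqP <-|no_y] //.
- by move/injection_inj->.
- by move/(out _ _ no_y).
- by move/esym/(out _ _ no_x).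
Qed.

(* pi_s, extended by the identity outside {i_1, ..., i_k}; this does not change
   the sign. *)
Definition inj_perm s : {perm 'I_n} := perm (@inj_perm_fun_inj s).

Lemma inj_permE s a : inj_perm s (inj_index s a) = val s a.
Proof.
rewrite permE /inj_perm_fun; case: pickP => [b /eqP/inj_index_inj-> //|].
by move/(_ a); rewrite eqxx.
Qed.

Lemma inj_perm_on s : perm_on (inj_image s) (inj_perm s).
Proof.
apply/subsetP => x; rewrite inE permE /inj_perm_fun.
case: pickP => [a /eqP <- _|_]; first exact: inj_index_in.
by rewrite eqxx.
Qed.

End Injections.

Lemma incr_ord_ge (k n : nat) (i : 'I_k -> 'I_n) :
  (forall a b : 'I_k, (a < b)%N -> (i a < i b)%N) ->
  forall a : 'I_k, (a <= i a)%N.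
Proof.
move=> i_incr [m]; elim: m => [//|m IHm] lt_m /=.
exact: leq_ltn_trans (IHm (ltnW lt_m)) (i_incr (Ordinal (ltnW lt_m)) _ _).
Qed.

Lemma inj_index_ge (k n : nat) (s : injection k n) (a : 'I_k) :
  (a <= inj_index s a)%N.
Proof. by apply: incr_ord_ge => b c; apply: inj_index_mono. Qed.

Section Cullis.
Variable F : fieldType.

(* Natural subtraction is not truncated here, by [inj_index_ge]; the shift to
   0-based indices cancels in i_a - a. *)
Definition cullis_sign (k n : nat) (s : injection k n) : F :=
  (-1) ^+ inj_perm s * (-1) ^+ (\sum_(a < k) (inj_index s a - a))%N.

Definition cullis_det (n k : nat) (X : 'M[F]_(n, k)) : F :=
  \sum_(s : injection k n) cullis_sign s * \prod_(a < k) X (val s a) a.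

Lemma cullis_det_square (k : nat) (X : 'M[F]_k) : cullis_det X = \det X.
Proof.
have idx (s : injection k k) a : inj_index s a = a.
  have imT : inj_image s = setT.
    by apply/eqP; rewrite eqEcard subsetT cardsT card_ord card_inj_image leqnn.
  by rewrite (inj_indexE s a) imT enum_setT -enumT nth_ord_enum.
have permE' (s : injection k k) : inj_perm s =1 val s.
  by move=> a; rewrite -[in LHS](idx s a) inj_permE.
have ofinj (p : {perm 'I_k}) : injectiveb [ffun a => p a].
  by apply/injectiveP => a b; rewrite !ffunE; apply: perm_inj.
pose h (p : {perm 'I_k}) : injection k k := Sub [ffun a => p a] (ofinj p).
have hK : cancel h (@inj_perm k k).
  by move=> p; apply/permP => a; rewrite permE' /= ffunE.
have Kh : cancel (@inj_perm k k) h.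
  by move=> s; apply/val_inj/ffunP => a; rewrite /= ffunE permE'.
rewrite -det_tr /determinant /cullis_det (reindex h) /=; last first.
  by exists (@inj_perm k k) => ? _; rewrite ?hK ?Kh.
apply: eq_bigr => p _; rewrite /cullis_sign hK big1 => [|a _]; last first.
  by rewrite idx subnn.
by rewrite mulr1; congr (_ * _); apply: eq_bigr => a _; rewrite ffunE mxE.
Qed.

(* W_{n k} *)
Definition equal_rows (n k : nat) : {pred 'M[F]_(n, k)} :=
  [pred X | [forall i, forall j, row i X == row j X]].

End Cullis.
Arguments equal_rows {F n k}.

(* Main.v *)
Require Import Defs.
From HB Require Import structures.
From mathcomp Require Import all_boot all_order all_fingroup all_algebra.
From mathcomp Require Import ring zify.
Set Implicit Arguments.
Unset Strict Implicit.
Unset Printing Implicit Defensive.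
Import GRing.Theory.
Local Open Scope ring_scope.

(* Write det for the n x k Cullis determinant. It is an alternating k-form in
   the columns, whose value on the basis vectors e_(s 1), ..., e_(s k) is, up to
   a global sign, the product of the (-1) ^ (s a) and of the signs of the
   differences s b - s a for a < b. As n + k is odd, the all-ones vector lies in
   the kernel of this form, so that det lives on M / W.

   Contracting the form with e_i + e_(i+1) and e_j + e_(j+1), and with k - 4
   further basis vectors, gives the 2-form d_i /\ d_j up to sign, where
   d_i = x_i - x_(i+1); likewise for e_(i-1) + e_(i+2) in place of the second
   vector. Hence, as k >= 4, two columns v, w such that det vanishes on all
   matrices containing them are dependent modulo the all-ones vector. It follows
   that the radical of det is W and, since |F| > k, that Y has rank at most one
   modulo W as soon as t |-> det (X + t Y) is affine for all X. The converse
   being clear for rank-one Y, a preserver T of det induces an injective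
   endomorphism of M / W = F^(n-1) (x) F^k which preserves matrices of rank at
   most one; as n - 1 > k, it has the form X |-> A X B. *)

(** * The sign in closed form *)

(** Each transposition in a factorization of [t] is transported along [i] to a transposition of
    values, so the parity is kept. *)
Lemma perm_extend k n (i : 'I_k -> 'I_n) (t : 'S_k) : injective i ->
  exists p : 'S_n, [/\ forall a, p (i a) = i (t a),
    forall x, (forall a, i a != x) -> p x = x & odd_perm p = odd_perm t].
Proof.
move=> i_inj; have [ts -> {t}] := prod_tpermP t.
elim: ts => [|[b c] ts IH] /=.
  by rewrite !big_nil; exists 1%g; split=> [a|x _|]; rewrite ?perm1 ?odd_perm1.
case/andP=> /= nbc /IH[p [p_i p_out p_odd]]; rewrite big_cons /=.
exists (tperm (i b) (i c) * p)%g; split=> [a|x out_x|].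
- by rewrite !permM -inj_tperm // p_i.
- by rewrite permM tpermD ?p_out.
- by rewrite !odd_permM !odd_tperm (inj_eq i_inj) p_odd.
Qed.

Section Sign.
Variable F : fieldType.

(** Taken over the integers and then cast, since [F] carries no order. *)
Definition sg (x y : nat) : F := (sgz (y%:Z - x%:Z))%:~R.

Lemma sgE x y :
  sg x y = if (x < y)%N then 1 else if (y < x)%N then -1 else 0.
Proof.
rewrite /sg; case: ltngtP => xy.
- by rewrite gtr0_sgz //; lia.
- by rewrite ltr0_sgz //; lia.
- by rewrite xy subrr sgz0.
Qed.

Variables k n : nat.
Implicit Types s : 'I_k -> 'I_n.

(* [cullis_sign] in closed form, extended by 0 to the non-injective maps. *)
Definition eps s : F :=
  \prod_(a < k) (-1) ^+ (s a + a)%N *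
  \prod_(a < k) \prod_(b < k | (a < b)%N) sg (s a) (s b).

(** The product is the sign of an integer Vandermonde determinant, whose columns are permuted by
    [t]. *)
Lemma prod_sg_perm s (t : 'S_k) :
  \prod_(a < k) \prod_(b < k | (a < b)%N) sg (s (t a)) (s (t b)) =
  (-1) ^+ t * \prod_(a < k) \prod_(b < k | (a < b)%N) sg (s a) (s b).
Proof.
have sgz_prod s' : \prod_(a < k) \prod_(b < k | (a < b)%N) sg (s' a) (s' b) =
    (sgz (\det (Vandermonde k (\row_j (s' j : nat)%:Z))))%:~R.
  have sgz_morph := big_morph (@sgz int) (@sgzM _) (@sgz1 _).
  rewrite det_Vandermonde sgz_morph rmorph_prod; apply: eq_bigr => a _.
  by rewrite sgz_morph rmorph_prod; apply: eq_bigr => b _; rewrite /sg !mxE.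
rewrite (sgz_prod (s \o t)) sgz_prod.
set V := Vandermonde k (\row_j (s j : nat)%:Z).
have -> : Vandermonde k (\row_j ((s \o t) j : nat)%:Z) = col_perm t V.
  by apply/matrixP=> a b; rewrite !mxE.
rewrite col_permE det_mulmx det_perm odd_permV sgzM rmorphM mulrC.
by congr (_ * _); case: (odd_perm t).
Qed.

Lemma eps_perm s (t : 'S_k) : eps (s \o t) = (-1) ^+ t * eps s.
Proof.
rewrite /eps prod_sg_perm mulrCA; congr (_ * (_ * _)).
rewrite -!expr_sum !big_split /= !exprD; congr (_ ^+ _ * _).
by rewrite [in RHS](reindex_perm t).
Qed.

Lemma eps_noninj s (a b : 'I_k) : a != b -> s a = s b -> eps s = 0.
Proof.
wlog ltab : a b / (a < b)%N.
  move=> W nab sab; case: (ltngtP a b) => [ab|ab|/val_inj ab].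
  - exact: W ab nab sab.
  - by apply: W ab _ _; rewrite // eq_sym.
  - by rewrite ab eqxx in nab.
move=> _ sab; rewrite /eps [X in _ * X](bigD1 a) //=.
rewrite [X in _ * (X * _)](bigD1 b) //=.
by rewrite sab [sg _ _]sgE ltnn !mul0r mulr0.
Qed.

Lemma eps_incr s : (forall a b : 'I_k, (a < b)%N -> (s a < s b)%N) ->
  eps s = (-1) ^+ (\sum_(a < k) (s a - a))%N.
Proof.
move=> s_incr; rewrite /eps [X in _ * X]big1 ?mulr1 => [|a _]; last first.
  by apply: big1 => b ab; rewrite sgE s_incr.
rewrite -expr_sum -signr_odd -[RHS]signr_odd; congr (_ ^+ nat_of_bool _).
have -> : (\sum_(a < k) (s a + a) =
           \sum_(a < k) (s a - a) + (\sum_(a < k) a).*2)%N.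
  rewrite -addnn -!big_split; apply: eq_bigr => a _ /=.
  by have := incr_ord_ge s_incr a; lia.
by rewrite oddD odd_double addbF.
Qed.

Lemma inj_index_perm (s : injection k n) :
  exists t : 'S_k, val s =1 inj_index s \o t.
Proof.
have ex_t a : exists b, inj_index s b == val s a.
  by have [|b <-] := @inj_index_onto _ _ s (val s a); [exact: imset_f|exists b].
have idxt a : inj_index s (xchoose (ex_t a)) = val s a.
  exact/eqP/(xchooseP (ex_t a)).
have t_inj : injective (fun a => xchoose (ex_t a)).
  move=> a b /(congr1 (inj_index s)); rewrite !idxt; exact: injection_inj.
by exists (perm t_inj) => a; rewrite /= permE idxt.
Qed.

Lemma eq_eps s s' : s =1 s' -> eps s = eps s'.
Proof.
move=> es; congr (_ * _); first by apply: eq_bigr => a _; rewrite es.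
by apply: eq_bigr => a _; apply: eq_bigr => b _; rewrite !es.
Qed.

Lemma cullis_signE (s : injection k n) : cullis_sign F s = eps (val s).
Proof.
have [t st] := inj_index_perm s.
have [p [p_i p_out p_odd]] := perm_extend t (@inj_index_inj _ _ s).
rewrite (eq_eps st) eps_perm eps_incr ?/cullis_sign -?p_odd; last first.
  exact: inj_index_mono.
(* Both permutations send [inj_index s a] to [val s a] and fix all other points. *)
congr ((-1) ^+ nat_of_bool (odd_perm _) * _); apply/permP => x.
have [/existsP[a /eqP <-]|] := boolP [exists a, inj_index s a == x].
  by rewrite inj_permE p_i st.
rewrite negb_exists => /forallP out_x; rewrite p_out //.
have := inj_perm_on s; rewrite /perm_on => /subsetP/(_ x)/contraNeq; apply.
by apply/negP => /inj_index_onto[a ax]; have := out_x a; rewrite ax eqxx.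
Qed.

End Sign.

(** * Alternation and multilinearity *)

Section CullisTheory.
Variables (F : fieldType) (n k : nat).
Implicit Types (X Y : 'M[F]_(n, k)) (s : {ffun 'I_k -> 'I_n}).

(** The non-injective terms vanish with [eps]; a sum over all functions is what distributing
    products over sums produces. *)
Lemma cullis_detE X : cullis_det X =
  \sum_(s : {ffun 'I_k -> 'I_n}) eps F s * \prod_(a < k) X (s a) a.
Proof.
rewrite [RHS](bigID (fun s => injectiveb s)) /= addrC big1 ?add0r.
  rewrite [RHS](reindex_omap (val : injection k n -> _) insub) /=; last first.
    by move=> s s_inj; rewrite insubT.
  apply: eq_big => [s|s _]; last by rewrite cullis_signE.
  by rewrite valK eqxx (valP s).
by move=> s /injectivePn[a [b nab sab]]; rewrite (eps_noninj F nab sab) mul0r.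
Qed.

Lemma ffun_perm_bij (t : 'S_k) :
  bijective (fun s => [ffun a => s (t a)] : {ffun 'I_k -> 'I_n}).
Proof.
exists (fun s => [ffun a => s (t^-1%g a)] : {ffun 'I_k -> 'I_n}) => s;
  by apply/ffunP => a; rewrite !ffunE ?permK ?permKV.
Qed.

Lemma cullis_colsub_perm m (A : 'M[F]_(n, m)) (r : 'I_k -> 'I_m) (t : 'S_k) :
  cullis_det (colsub (r \o t) A) = (-1) ^+ t * cullis_det (colsub r A).
Proof.
rewrite !cullis_detE (reindex _ (onW_bij _ (ffun_perm_bij t))) mulr_sumr /=.
apply: eq_bigr => s _; rewrite (eq_eps _ (s' := s \o t)) => [|a]; last first.
  by rewrite ffunE.
rewrite eps_perm -mulrA [in RHS](reindex_perm t); congr (_ * (_ * _)).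
by apply: eq_bigr => a _; rewrite !mxE ffunE.
Qed.

(** Antisymmetry alone would only kill twice the determinant. Cancelling each term with [s b < s c]
    against its image under the transposition also covers characteristic 2. *)
Lemma cullis_colsub_noninj m (A : 'M[F]_(n, m)) (r : 'I_k -> 'I_m)
  (b c : 'I_k) : b != c -> r b = r c -> cullis_det (colsub r A) = 0.
Proof.
move=> nbc rbc; pose t := tperm b c; rewrite cullis_detE.
pose G s := eps F s * \prod_(a < k) colsub r A (s a) a.
have Gsplit s : G s = (if (s b < s c)%N then G s else 0) +
                      (if (s c < s b)%N then G s else 0).
  case: ltngtP => [||/val_inj sbc]; rewrite ?addr0 ?add0r //.
  by rewrite /G (eps_noninj F nbc sbc) mul0r.
rewrite (eq_bigr _ (fun s _ => Gsplit s)) big_split /=.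
rewrite [X in _ + X](reindex _ (onW_bij _ (ffun_perm_bij t))) /=.
rewrite -big_split big1 // => s _ /=; rewrite !ffunE tpermL tpermR.
case: ifP; rewrite ?addr0 // => _; rewrite /G.
rewrite (eq_eps _ (s := [ffun a => s (t a)]) (s' := s \o t)); last first.
  by move=> a; rewrite ffunE.
rewrite eps_perm odd_tperm nbc expr1 mulN1r mulNr; apply/eqP.
rewrite subr_eq0; apply/eqP; congr (_ * _).
rewrite [RHS](reindex_perm t); apply: eq_bigr => a _ /=.
by rewrite !mxE ffunE tpermK /t; case: tpermP => [->|->|]; rewrite ?rbc.
Qed.

Lemma cullis_mulmxl m (A : 'M[F]_(n, m)) (X : 'M[F]_(m, k)) :
  cullis_det (A *m X) = \sum_(r : {ffun 'I_k -> 'I_m})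
    (\prod_(a < k) X (r a) a) * cullis_det (colsub r A).
Proof.
rewrite cullis_detE; under eq_bigr => s _.
  under eq_bigr => a _ do rewrite mxE.
  rewrite bigA_distr_bigA mulr_sumr /=; over.
rewrite exchange_big /=; apply: eq_bigr => r _; rewrite cullis_detE mulr_sumr.
apply: eq_bigr => s _; rewrite big_split /= [in RHS]mulrCA; congr (_ * _).
rewrite mulrC; congr (_ * _).
by apply: eq_bigr => a _; rewrite mxE.
Qed.

(** By alternation only permutations survive in the expansion, and they add up to the Leibniz
    formula for [\det B]. *)
Lemma cullis_mulmxr X (B : 'M[F]_k) :
  cullis_det (X *m B) = cullis_det X * \det B.
Proof.
rewrite cullis_mulmxl (bigID (fun r : {ffun 'I_k -> 'I_k} => injectiveb r)) /=.
rewrite addrC big1 ?add0r => [|r /injectivePn[b [c nbc rbc]]]; last first.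
  by rewrite (cullis_colsub_noninj _ nbc rbc) mulr0.
rewrite -det_tr mulr_sumr.
rewrite (reindex (@pval _)) /=; last first.
  pose in_Sk := insubd (1%g : 'S_k).
  by exists in_Sk => /= f Uf; first apply: val_inj; apply: insubdK.
apply: eq_big => [t|t _]; rewrite ?(valP t) // pvalE.
rewrite (cullis_colsub_perm X id t) mulrC mulrCA mulrA; congr (_ * _).
  by congr (_ * cullis_det _); apply/matrixP=> a b; rewrite mxE.
by apply: eq_bigr => a _; rewrite mxE.
Qed.

Definition setcol X (j : 'I_k) (c : 'cV[F]_n) : 'M[F]_(n, k) :=
  \matrix_(x, a) if a == j then c x 0 else X x a.

Lemma cullis_setcol X j c : cullis_det (setcol X j c) =
  \sum_(s : {ffun 'I_k -> 'I_n})
    eps F s * (c (s j) 0 * \prod_(a < k | a != j) X (s a) a).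
Proof.
rewrite cullis_detE; apply: eq_bigr => s _; congr (_ * _).
rewrite (bigD1 j) //= mxE eqxx; congr (_ * _).
by apply: eq_bigr => a /negPf aj; rewrite mxE aj.
Qed.

Lemma cullis_setcolD X j c d :
  cullis_det (setcol X j (c + d)) =
  cullis_det (setcol X j c) + cullis_det (setcol X j d).
Proof.
rewrite !cullis_setcol -big_split; apply: eq_bigr => s _ /=.
by rewrite mxE mulrDl mulrDr.
Qed.

Lemma cullis_setcolZ X j z c :
  cullis_det (setcol X j (z *: c)) = z * cullis_det (setcol X j c).
Proof.
rewrite !cullis_setcol mulr_sumr; apply: eq_bigr => s _.
by rewrite mxE; ring.
Qed.

Lemma setcol_id X j : setcol X j (col j X) = X.
Proof. by apply/matrixP=> x a; rewrite !mxE; case: eqP => [->|]. Qed.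

Lemma cullis_addcol X j c :
  cullis_det (X + c *m delta_mx 0 j) = cullis_det X + cullis_det (setcol X j c).
Proof.
have -> : X + c *m delta_mx 0 j = setcol X j (col j X + c).
  apply/matrixP=> x a; rewrite !mxE big_ord1 !mxE eqxx andTb.
  by case: eqP => [->|_]; rewrite ?mulr1 ?mulr0 ?addr0.
by rewrite cullis_setcolD setcol_id.
Qed.

End CullisTheory.

(** * Expansion along the first columns *)

Section ListForm.
Variable F : fieldType.
Notation sg := (sg F).

(** Recursive form of [eps] on the list of values. Tail sizes replace the positions; both run
    through 0, ..., k - 1. *)
Fixpoint epsl (l : seq nat) : F :=
  if l is x :: l' then
    (-1) ^+ (x + size l')%N * \prod_(y <- l') sg x y * epsl l'
  else 1.

Lemma eps_epsl k n (s : 'I_k -> 'I_n) :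
  eps F s = epsl [seq (s a : nat) | a <- enum 'I_k].
Proof.
elim: k s => [|k IH] s.
  by rewrite /eps !big_ord0 (size0nil (size_enum_ord 0)) mulr1.
rewrite enum_ordSl /= -map_comp -(IH (s \o lift ord0)) size_map size_enum_ord.
rewrite /eps !big_ord_recl big_map big_enum /= addn0.
have -> : \prod_(b < k.+1 | (0 < b)%N) sg (s ord0) (s b) =
    \prod_(b < k) sg (s ord0) (s (lift ord0 b)).
  by rewrite big_mkcond big_ord_recl /= mul1r.
have -> : \prod_(a < k) (-1) ^+ (s (lift ord0 a) + bump 0 a)%N =
    (-1) ^+ k * \prod_(a < k) (-1) ^+ (s (lift ord0 a) + a)%N :> F.
  rewrite -[in X in X * _](card_ord k) -prodr_const -big_split /=.
  by apply: eq_bigr => a _; rewrite /bump add1n addnS exprS.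
have -> : \prod_(a < k) \prod_(b < k.+1 | (bump 0 a < b)%N)
      sg (s (lift ord0 a)) (s b) =
    \prod_(a < k) \prod_(b < k | (a < b)%N)
      sg (s (lift ord0 a)) (s (lift ord0 b)).
  apply: eq_bigr => a _; rewrite big_mkcond big_ord_recl /= mul1r.
  by rewrite -big_mkcond; apply: eq_bigl => b.
by rewrite exprD; ring.
Qed.

Lemma prod_sg_notin x l :
  x \notin l -> \prod_(y <- l) sg x y = (-1) ^+ count (fun y => y < x)%N l.
Proof.
elim: l => [|y l IH]; first by rewrite big_nil.
rewrite inE negb_or big_cons => /andP[nxy /IH->] /=; rewrite exprD sgE.
by case: ltngtP nxy => // [] _ _; rewrite ?expr0 ?expr1.
Qed.

Lemma prod_sg_in x l : x \in l -> \prod_(y <- l) sg x y = 0.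
Proof.
by move=> xl; rewrite (big_rem x) //= [sg x x]sgE ltnn mul0r.
Qed.

Lemma epsl_nuniq l : ~~ uniq l -> epsl l = 0.
Proof.
elim: l => //= x l IH; rewrite negb_and negbK => /orP[xl|/IH->].
  by rewrite prod_sg_in // mulr0 mul0r.
by rewrite mulr0.
Qed.

Lemma epsl_uniq l : uniq l -> epsl l != 0.
Proof.
elim: l => [|x l IH] /=; first by rewrite oner_eq0.
case/andP=> xl /IH nz; rewrite prod_sg_notin // -exprD mulf_neq0 //.
by rewrite signr_eq0.
Qed.

(* The summand vanishes on l and alternates between 1 and -1 outside l. *)
Lemma alternating_sum l m : uniq l ->
  \sum_(x < m) (-1) ^+ x * \prod_(y <- l) sg x y =
  (odd (m + count (fun y => y < m)%N l))%:R.
Proof.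
move=> l_uniq; elim: m => [|m IH].
  by rewrite big_ord0 (eq_count (a2 := pred0)) // count_pred0.
have cntS : count (fun y => y < m.+1)%N l =
    (count (fun y => y < m)%N l + (m \in l))%N.
  rewrite -(count_uniq_mem m l_uniq) -count_predUI.
  rewrite [X in (_ + X)%N](eq_count (a2 := pred0)) ?count_pred0 ?addn0.
    by apply: eq_count => y /=; lia.
  by move=> y /=; lia.
rewrite big_ord_recr IH cntS /= addnA.
have [ml|ml] := boolP (m \in l).
  by rewrite prod_sg_in // mulr0 addr0 addn1 /= negbK.
rewrite prod_sg_notin // -exprD addn0 -signr_odd.
by case: odd; rewrite ?subrr ?add0r.
Qed.

Variable n : nat.
Implicit Types cs : seq 'cV[F]_n.

(** Multilinear expansion done one column at a time, so that prescribed leading columns can be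
    summed out; [H] receives the list of chosen rows. *)
Fixpoint isum cs (H : seq nat -> F) : F :=
  if cs is c :: cs' then
    \sum_(x < n) c x 0 * isum cs' (fun l => H ((x : nat) :: l))
  else H [::].

Lemma isumE k (X : 'M[F]_(n, k)) (H : seq nat -> F) :
  \sum_(s : {ffun 'I_k -> 'I_n})
    H [seq (s a : nat) | a <- enum 'I_k] * \prod_(a < k) X (s a) a =
  isum [seq col a X | a <- enum 'I_k] H.
Proof.
elim: k X H => [|k IH] X H.
  have e0 := size0nil (size_enum_ord 0); rewrite e0 /=.
  rewrite (big_pred1 [ffun a : 'I_0 => widen_ord (leq0n n) a]).
    by rewrite big_ord0 mulr1.
  by move=> s; rewrite /= [RHS](_ : _ = true) //; apply/eqP/ffunP => -[].
rewrite enum_ordSl /= -map_comp.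
pose h (u : 'I_n * {ffun 'I_k -> 'I_n}) : {ffun 'I_k.+1 -> 'I_n} :=
  [ffun a => if unlift ord0 a is Some b then u.2 b else u.1].
rewrite (reindex h) /=; last first.
  exists (fun s => (s ord0, [ffun b => s (lift ord0 b)])) => [[x s] _|s _].
    congr (_, _); first by rewrite ffunE unlift_none.
    by apply/ffunP => b; rewrite !ffunE liftK.
  apply/ffunP => a; rewrite ffunE; case: unliftP => [b ->|->] //.
  by rewrite ffunE.
rewrite -(pair_bigA _ (fun x s => H [seq (h (x, s) a : nat) | a <-
  ord0 :: [seq lift ord0 i | i <- enum 'I_k]] * \prod_a X (h (x, s) a) a)) /=.
apply: eq_bigr => x _; rewrite mxE.
have -> : [seq ((fun a => col a X) \o lift ord0) i | i <- enum 'I_k] =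
    [seq col i (colsub (lift ord0) X) | i <- enum 'I_k].
  by apply: eq_map => i; apply/colP => y; rewrite !mxE.
rewrite -IH mulr_sumr; apply: eq_bigr => s _.
rewrite big_ord_recl /= -map_comp ffunE unlift_none /= mulrCA.
congr (_ * (H (_ :: _) * _)).
  by apply: eq_map => a; rewrite /= ffunE liftK.
by apply: eq_bigr => a _; rewrite ffunE liftK mxE.
Qed.

Lemma cullis_isum k (X : 'M[F]_(n, k)) :
  cullis_det X = isum [seq col a X | a <- enum 'I_k] epsl.
Proof.
by rewrite cullis_detE -isumE; apply: eq_bigr => s _; rewrite eps_epsl.
Qed.

Lemma isum_sum cs (I : finType) (H : I -> seq nat -> F) :
  \sum_i isum cs (H i) = isum cs (fun l => \sum_i H i l).
Proof.
elim: cs H => //= c cs IH H; rewrite exchange_big /=; apply: eq_bigr => x _.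
by rewrite -IH mulr_sumr.
Qed.

Lemma isum0 cs (H : seq nat -> F) :
  (forall l, size l = size cs -> all (fun x => x < n)%N l -> H l = 0) ->
  isum cs H = 0.
Proof.
elim: cs H => [|c cs IH] H H0 /=; first exact: H0.
apply: big1 => x _; rewrite IH ?mulr0 // => l sl ltl.
by apply: H0; rewrite /= ?sl ?ltn_ord.
Qed.

Lemma isum_delta (J : seq 'I_n) (H : seq nat -> F) :
  isum [seq delta_mx y 0 | y <- J] H = H [seq nat_of_ord y | y <- J].
Proof.
elim: J H => //= y J IH H; rewrite (bigD1 y) //= big1 ?addr0.
  by rewrite mxE !eqxx mul1r IH.
by move=> x /negPf xy; rewrite mxE xy mul0r.
Qed.

(** For fixed rows [l] of the other columns, the sum over the first row is an alternating sum over
    the n - [size l] remaining rows, an even number. *)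
Lemma isum_ones cs : odd (n + (size cs).+1) -> isum (const_mx 1 :: cs) epsl = 0.
Proof.
move=> odd_n /=; under eq_bigr do rewrite mxE mul1r.
rewrite isum_sum; apply: isum0 => l sl ltl.
have [ul|/epsl_nuniq l0] := boolP (uniq l); last first.
  by apply: big1 => x _ /=; rewrite l0 mulr0.
transitivity ((-1) ^+ size l * epsl l *
    \sum_(x < n) (-1) ^+ x * \prod_(y <- l) sg x y).
  by rewrite mulr_sumr; apply: eq_bigr => x _; rewrite /= exprD; ring.
rewrite alternating_sum //; move: (ltl); rewrite all_count => /eqP->.
by move: odd_n; rewrite addnS /= sl => /negPf->; rewrite mulr0.
Qed.

End ListForm.

Lemma cullis_ones (F : fieldType) n k (X : 'M[F]_(n, k)) j :
  odd (n + k) -> col j X = const_mx 1 -> cullis_det X = 0.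
Proof.
case: k X j => [|k] X j; first by case: j.
move=> odd_nk Xj; pose t := tperm ord0 j.
have : cullis_det (colsub t X) = 0.
  rewrite cullis_isum enum_ordSl /=.
  have -> : col ord0 (colsub t X) = const_mx 1.
    by rewrite -Xj; apply/colP => x; rewrite !mxE tpermL.
  by apply: isum_ones; rewrite -map_comp size_map size_enum_ord.
have := cullis_colsub_perm X id t => /= ->; rewrite (_ : colsub id X = X).
  by move/eqP; rewrite mulf_eq0 signr_eq0 => /eqP.
by apply/matrixP=> x y; rewrite mxE.
Qed.

(** * Contractions of the Cullis form *)

(* j < j1 are consecutive in the complement of {i, i + 1}: either both on its
   right, or one on each side. *)
Definition linked (i j j1 : nat) :=
  (i.+1 < j)%N && (j1 == j.+1) || (i == j.+1) && (j1 == j.+3).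

(** All 2 x 2 minors [D] of consecutive differences vanish: the distant ones by hypothesis, the
    adjacent ones because they are all equal and satisfy a Plücker relation. Telescoping
    concludes. *)
Lemma parallel_differences (F : fieldType) (N : nat) (V W : nat -> F) :
  (4 <= N)%N ->
  (forall i j j1, linked i j j1 -> (i.+1 <= N)%N -> (j1 <= N)%N ->
    (V i - V i.+1) * (W j - W j1) = (V j - V j1) * (W i - W i.+1)) ->
  forall p q, (p <= N)%N -> (q <= N)%N ->
    (V p - V 0%N) * (W q - W 0%N) = (V q - V 0%N) * (W p - W 0%N).
Proof.
move=> N4 VW.
pose D i j := (V i - V i.+1) * (W j - W j.+1) - (V j - V j.+1) * (W i - W i.+1).
have Dfar i j : (i.+1 < j)%N -> (j < N)%N -> D i j = 0.
  by move=> ij jN; rewrite /D VW ?subrr // /linked; lia.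
(* In the linked pair around j + 1, the difference between j and j + 3 splits into three consecutive
   ones, the middle of which contributes nothing. *)
have Dstep j : (j.+3 <= N)%N -> D j.+1 j.+2 = D j j.+1.
  move=> jN; have := VW j.+1 j j.+3; rewrite /linked !eqxx orbT => /(_ isT).
  move=> /(_ (ltnW jN) jN) e; apply/eqP; rewrite -subr_eq0; apply/eqP.
  rewrite -(subrr ((V j - V j.+3) * (W j.+1 - W j.+2))) -{1}e /D; ring.
have Dadj j : (j.+2 <= N)%N -> D j j.+1 = D 0%N 1%N.
  by elim: j => // j IH jN; rewrite Dstep // IH // ltnW.
have D01 : D 0%N 1%N = 0.
  (* The right-hand side contains distant minors and [D 2 3] equals [D 0 1], so the square of
     [D 0 1] is zero; this uses 4 <= N. *)
  have pluecker : D 0%N 1%N * D 2 3 = D 0%N 2 * D 1%N 3 - D 0%N 3 * D 1%N 2.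
    by rewrite /D; ring.
  move: pluecker; rewrite (Dadj 2) ?(Dfar 0%N 2) ?(Dfar 0%N 3); try lia.
  rewrite !mul0r subrr.
  by move/eqP; rewrite mulf_eq0 orbb => /eqP.
have Dle i j : (i <= j)%N -> (j < N)%N -> D i j = 0.
  rewrite leq_eqVlt => /orP[/eqP->|ij] jN; first by rewrite /D subrr.
  move: (ij); rewrite leq_eqVlt => /orP[/eqP ej|]; last by move/Dfar; apply.
  by rewrite -ej Dadj ?D01 ?ej.
have D0 i j : (i < N)%N -> (j < N)%N -> D i j = 0.
  move=> iN jN; case: (leqP i j) => [/Dle->//|/ltnW ji].
  have /eqP := Dle _ _ ji iN; rewrite /D subr_eq0 => /eqP->.
  by rewrite subrr.
have step1 p j : (p <= N)%N -> (j < N)%N ->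
    (V p - V 0%N) * (W j - W j.+1) = (V j - V j.+1) * (W p - W 0%N).
  elim: p => [|p IH] pN jN; first by rewrite !subrr mul0r mulr0.
  have := D0 _ _ pN jN; have := IH (ltnW pN) jN; rewrite /D => e1 /eqP.
  rewrite subr_eq0 => /eqP e2.
  transitivity ((V p - V 0%N) * (W j - W j.+1) -
                (V p - V p.+1) * (W j - W j.+1)); first by ring.
  by rewrite e1 e2; ring.
move=> p q pN; elim: q => [|q IH] qN; first by rewrite !subrr mul0r mulr0.
transitivity ((V p - V 0%N) * (W q - W 0%N) -
              (V p - V 0%N) * (W q - W q.+1)); first by ring.
by rewrite IH ?(ltnW qN) // step1 //; ring.
Qed.

Section Contraction.
Variable F : fieldType.
Notation sg := (sg F).
Notation epsl := (epsl F).

(** [G x y] is, up to a common factor, the form on e_p, e_q, e_x, e_y and fixed further basis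
    vectors. Summing over both pairs gives a multiple of d_i /\ d_j at (e_p, e_q), by deciding all
    order relations. *)
Lemma four_term (h : nat -> F) (p q i j j1 : nat) :
  h i.+1 = - h i -> h j1 = - h j -> linked i j j1 ->
  let G x y := h p * h q * h x * h y *
    (sg p q * sg p x * sg p y * sg q x * sg q y * sg x y) in
  G i j + G i j1 + (G i.+1 j + G i.+1 j1) =
  - (h i ^+ 2 * h j ^+ 2) *
    (((p == i)%:R - (p == i.+1)%:R) * ((q == j)%:R - (q == j1)%:R) -
     ((p == j)%:R - (p == j1)%:R) * ((q == i)%:R - (q == i.+1)%:R)).
Proof.
move=> hi hj ij G; rewrite {}/G !sgE.
case/orP: ij => /andP[] => [ij /eqP ej1|/eqP ei /eqP ej1]; subst;
repeat match goal with
| |- context [(?x < ?y)%N] => case: (ltngtP x y) => ?; try (exfalso; lia)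
| |- context [eqn ?x ?y] => case: (ltngtP x y) => ?; try (exfalso; lia)
| |- context [?x == ?y] => case: (ltngtP x y) => ?; try (exfalso; lia)
end; subst; rewrite ?hi ?hj ?mulr1n ?mulr0n; ring.
Qed.

Lemma eq_sg (x y t : nat) :
  (x < t)%N = (y < t)%N -> (t < x)%N = (t < y)%N -> sg x t = sg y t.
Proof. by move=> e1 e2; rewrite !sgE e1 e2. Qed.

Lemma epsl4 (p q x y : nat) (J : seq nat) :
  let h z := (-1) ^+ z * \prod_(t <- J) sg z t in
  epsl [:: p, q, x, y & J] = h p * h q * h x * h y *
    (sg p q * sg p x * sg p y * sg q x * sg q y * sg x y) * epsl J.
Proof.
move=> h; rewrite /= !big_cons /h !exprD !exprS.
by rewrite -(signr_odd F (size J)); case: odd; rewrite ?expr0 ?expr1; ring.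
Qed.

Lemma contraction_parallel n m (v w : 'cV[F]_n) (i i1 j j1 : 'I_n) :
  (m.+4 <= n)%N -> i1 = i.+1 :> nat -> linked i j j1 ->
  (forall X : 'M[F]_(n, m.+4),
    col 0 X = v -> col 1 X = w -> cullis_det X = 0) ->
  (v i 0 - v i1 0) * (w j 0 - w j1 0) = (v j 0 - v j1 0) * (w i 0 - w i1 0).
Proof.
move=> mn ei1 lij X0.
(* The further basis vectors avoid the four contracted rows; m + 4 <= n leaves enough of them. *)
pose J := take m (enum (~: [set x in [:: i; i1; j; j1]])).
have sJ : size J = m.
  rewrite size_takel // -cardE cardsCs setCK card_ord.
  rewrite cardsE; apply: leq_trans (leq_sub2l n (card_size _)).
  by rewrite /=; lia.
have uJ : uniq J by rewrite take_uniq ?enum_uniq.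
have outJ x : x \in J -> [/\ x <> i :> nat, x <> i1 :> nat,
    x <> j :> nat & x <> j1 :> nat].
  move/mem_take; rewrite mem_enum !inE !negb_or.
  case/and4P=> /eqP ? /eqP ? /eqP ? /eqP ?.
  by split=> /val_inj.
pose l := [seq nat_of_ord y | y <- J].
have ul : uniq l by rewrite map_inj_uniq //; exact: ord_inj.
pose h z : F := (-1) ^+ z * \prod_(t <- l) sg z t.
have hi1 : h i.+1 = - h i.
  rewrite /h exprS mulN1r mulNr; congr (- (_ * _)).
  rewrite !big_map big_seq [RHS]big_seq; apply: eq_bigr => x /outJ[] *.
  by apply: eq_sg; lia.
(* The distance from [j] to [j1] is 1 or 3, hence odd, and any rows strictly between are [i] and
   [i1], which [J] avoids. *)
have hj1 : h j1 = - h j.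
  rewrite /h (_ : (-1) ^+ j1 = - (-1) ^+ j :> F); last first.
    by case/orP: lij => /andP[_ /eqP->]; rewrite ?exprS; ring.
  rewrite mulNr; congr (- (_ * _)).
  rewrite !big_map big_seq [RHS]big_seq; apply: eq_bigr => x /outJ[] *.
  by move: lij; rewrite /linked => ?; apply: eq_sg; lia.
have h_neq0 z : z \notin l -> h z != 0.
  by move=> zl; rewrite /h prod_sg_notin // -exprD signr_eq0.
have notl (x : 'I_n) : x \in [:: i; i1; j; j1] -> (x : nat) \notin l.
  move=> xb; rewrite (mem_map (@ord_inj n)); apply/negP => /mem_take.
  by rewrite mem_enum in_setC inE xb.
pose u1 : 'cV[F]_n := delta_mx i 0 + delta_mx i1 0.
pose u2 : 'cV[F]_n := delta_mx j 0 + delta_mx j1 0.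
pose cs := [:: v, w, u1, u2 & [seq delta_mx y 0 : 'cV[F]_n | y <- J]].
have scs : size cs = m.+4 by rewrite /= size_map sJ.
pose X : 'M[F]_(n, m.+4) := \matrix_(x, a) (nth 0 cs a) x 0.
have colX a : col a X = nth 0 cs a by apply/colP => x; rewrite !mxE.
have := X0 X (colX _) (colX _); rewrite cullis_isum.
have -> : [seq col a X | a <- enum 'I_m.+4] = cs.
  apply: (@eq_from_nth _ 0); first by rewrite size_map size_enum_ord.
  move=> a; rewrite size_map size_enum_ord => ltam.
  by rewrite (nth_map ord0) ?size_enum_ord // colX nth_enum_ord.
have sum_u (a b : 'I_n) (G : 'I_n -> F) :
    \sum_x (delta_mx a 0 + delta_mx b 0 : 'cV[F]_n) x 0 * G x = G a + G b.
  under eq_bigr do rewrite !mxE !eqxx !andbT mulrDl.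
  rewrite big_split /= (bigD1 a) //= eqxx mul1r big1 ?addr0; last first.
    by move=> x /negPf->; rewrite mul0r.
  congr (_ + _); rewrite (bigD1 b) //= eqxx mul1r big1 ?addr0 //.
  by move=> x /negPf->; rewrite mul0r.
have inner (p q : 'I_n) : \sum_x u1 x 0 * (\sum_y u2 y 0 *
      isum [seq delta_mx z 0 : 'cV[F]_n | z <- J]
        (fun l' => epsl [:: nat_of_ord p, nat_of_ord q, nat_of_ord x,
                            nat_of_ord y & l'])) =
    - (h i ^+ 2 * h j ^+ 2) * epsl l *
    (((p == i)%:R - (p == i1)%:R) * ((q == j)%:R - (q == j1)%:R) -
     ((p == j)%:R - (p == j1)%:R) * ((q == i)%:R - (q == i1)%:R)).
  rewrite sum_u !sum_u !isum_delta !epsl4 -!mulrDl ei1.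
  rewrite (four_term p q hi1 hj1 lij) -ei1 -!(inj_eq (@ord_inj n)); ring.
have -> : isum cs epsl = - (h i ^+ 2 * h j ^+ 2) * epsl l *
    (\sum_p \sum_q v p 0 * (w q 0 *
    (((p == i)%:R - (p == i1)%:R) * ((q == j)%:R - (q == j1)%:R) -
     ((p == j)%:R - (p == j1)%:R) * ((q == i)%:R - (q == i1)%:R)))).
  rewrite mulr_sumr; apply: eq_bigr => p _; rewrite !mulr_sumr.
  apply: eq_bigr => q _; rewrite [X in v p 0 * (w q 0 * X) = _]inner; ring.
have sum_d (c : 'cV[F]_n) (a b : 'I_n) :
    \sum_x c x 0 * ((x == a)%:R - (x == b)%:R) = c a 0 - c b 0.
  under eq_bigr do rewrite mulrBr.
  rewrite big_split sumrN /= (bigD1 a) //= eqxx mulr1 big1 ?addr0; last first.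
    by move=> x /negPf->; rewrite mulr0.
  congr (_ - _); rewrite (bigD1 b) //= eqxx mulr1 big1 ?addr0 //.
  by move=> x /negPf->; rewrite mulr0.
have -> : \sum_p \sum_q v p 0 * (w q 0 *
    (((p == i)%:R - (p == i1)%:R) * ((q == j)%:R - (q == j1)%:R) -
     ((p == j)%:R - (p == j1)%:R) * ((q == i)%:R - (q == i1)%:R))) =
    (v i 0 - v i1 0) * (w j 0 - w j1 0) - (v j 0 - v j1 0) * (w i 0 - w i1 0).
  rewrite -!sum_d !mulr_suml -sumrB; apply: eq_bigr => p _.
  rewrite !mulr_sumr -sumrB; apply: eq_bigr => q _; ring.
(* The factors [h i], [h j] and [epsl l] are signs, so the 2 x 2 minor itself vanishes. *)
move/eqP; rewrite !mulf_eq0 oppr_eq0 mulf_eq0 !expf_eq0 /=.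
rewrite (negPf (h_neq0 _ (notl i _))) ?inE ?eqxx //.
rewrite (negPf (h_neq0 _ (notl j _))) ?inE ?eqxx ?orbT //=.
by rewrite (negPf (epsl_uniq F ul)) subr_eq0 => /eqP.
Qed.

Lemma cullis_pair_parallel n k (v w : 'cV[F]_n.+1) (b c : 'I_k) :
  (4 <= k)%N -> (k <= n)%N -> b != c ->
  (forall X : 'M[F]_(n.+1, k),
    col b X = v -> col c X = w -> cullis_det X = 0) ->
  forall p q, (v p 0 - v 0 0) * (w q 0 - w 0 0) =
              (v q 0 - v 0 0) * (w p 0 - w 0 0).
Proof.
case: k b c => [|[|[|[|m]]]] // b c _ kn nbc vw0.
have vw0' (X : 'M[F]_(n.+1, m.+4)) :
    col 0 X = v -> col 1 X = w -> cullis_det X = 0.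
  move=> Xv Xw; pose c' := tperm 0 b c.
  have c'0 : c' != 0.
    by rewrite /c' -(inj_eq (@perm_inj _ (tperm 0 b))) tpermK tpermL eq_sym.
  (* A permutation with b -> 0 and c -> 1; [c'] is where the first transposition sends [c]. *)
  pose t := (tperm 0%R b * tperm c' 1%R)%g.
  have tb : t b = 0 by rewrite permM tpermR tpermD.
  have tc : t c = 1 by rewrite permM -/c' tpermL.
  have Xid : colsub id X = X by apply/matrixP=> x y; rewrite mxE.
  have := vw0 (colsub t X); rewrite (cullis_colsub_perm X id t) Xid.
  have -> : col b (colsub t X) = v.
    by rewrite -Xv; apply/colP => x; rewrite !mxE tb.
  have -> : col c (colsub t X) = w.
    by rewrite -Xw; apply/colP => x; rewrite !mxE tc.
  by move=> /(_ erefl erefl)/eqP; rewrite mulf_eq0 signr_eq0 => /eqP.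
pose V x := v (inord x) 0; pose W x := w (inord x) 0.
have VW := @parallel_differences F n V W.
move=> p q; have := VW _ _ p q (ltn_ord p) (ltn_ord q).
rewrite /V /W !inord_val.
rewrite (_ : inord 0 = 0); last by apply: ord_inj; rewrite inordK.
apply; first exact: leq_trans kn.
move=> i j j1 ij iN jN; apply: (contraction_parallel _ _ _ vw0').
- exact: leqW.
- by rewrite !inordK //; apply: leqW.
- by rewrite !inordK //; move: ij; rewrite /linked; lia.
Qed.

End Contraction.

(** * Preservers of matrices of rank at most one *)

Section RankOne.
Variable F : fieldType.

(** Stated through 2 x 2 minors, the form in which the contractions deliver it. *)
Definition rank_le1 m n (Z : 'M[F]_(m, n)) :=
  forall a b c d, Z a c * Z b d = Z a d * Z b c.

Lemma mul_col_rowE m n (u : 'cV[F]_m) (v : 'rV[F]_n) a c :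
  (u *m v) a c = u a 0 * v 0 c.
Proof. by rewrite mxE big_ord1. Qed.

Lemma rank_le1P m n (Z : 'M[F]_(m, n)) : rank_le1 Z ->
  exists u : 'cV[F]_m, exists v : 'rV[F]_n, Z = u *m v.
Proof.
move=> Z1; have [->|/matrix0Pn[a [c nz]]] := eqVneq Z 0.
  by exists 0, 0; rewrite mulmx0.
exists (col c Z), ((Z a c)^-1 *: row a Z); apply/matrixP=> b d.
by rewrite mul_col_rowE !mxE mulrCA mulrC -(Z1 b a d c) mulfK.
Qed.

(** Cauchy-Binet: the minors of the sum are products of a minor of (u0, u1) and a minor of (v0,
    v1). *)
Lemma rank_le1D m n (u0 u1 : 'cV[F]_m) (v0 v1 : 'rV[F]_n) :
  rank_le1 (u0 *m v0 + u1 *m v1) -> forall a b c d,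
  (u0 a 0 * u1 b 0 - u0 b 0 * u1 a 0) *
  (v0 0 c * v1 0 d - v0 0 d * v1 0 c) = 0.
Proof.
move=> H a b c d; have := H a b c d; rewrite !mxE !big_ord1.
by move/eqP; rewrite -subr_eq0 => /eqP <-; ring.
Qed.

Lemma parallel_colP m (u v : 'cV[F]_m) : u != 0 ->
  (forall a b, u a 0 * v b 0 = u b 0 * v a 0) -> exists z, v = z *: u.
Proof.
move=> /matrix0Pn[a [c]]; rewrite (ord1 c) => nz uv.
exists (v a 0 / u a 0); apply/colP => b; rewrite mxE mulrAC.
by rewrite [v a 0 * _]mulrC -uv mulrC mulKf.
Qed.

Lemma linear_cvE m n n' (M : {linear 'cV[F]_m -> 'M[F]_(n, n')}) z :
  M z = \sum_p z p 0 *: M (delta_mx p 0).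
Proof.
rewrite {1}[z]matrix_sum_delta raddf_sum; apply: eq_bigr => p _.
by rewrite big_ord1 /= linearZ.
Qed.

(** A linear space of matrices of rank at most one has a common row or a common column direction;
    the latter would embed F^m into F^k. *)
Lemma rank_le1_space m n k (M : {linear 'cV[F]_m -> 'M[F]_(n, k)}) :
  (k < m)%N -> (forall z, M z = 0 -> z = 0) -> (forall z, rank_le1 (M z)) ->
  exists A : 'M[F]_(n, m), exists b : 'rV[F]_k, forall z, M z = A *m z *m b.
Proof.
move=> km M_inj M1.
have ent z a c : M z a c = \sum_p z p 0 * M (delta_mx p 0) a c.
  by rewrite linear_cvE summxE; apply: eq_bigr => p _; rewrite mxE.
pose p0 := Ordinal (leq_ltn_trans (leq0n k) km).
pose z0 : 'cV[F]_m := delta_mx p0 0.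
have [u0 [b0 Mz0]] := rank_le1P (M1 z0).
have : u0 *m b0 != 0.
  rewrite -Mz0; apply/eqP => /M_inj/matrixP/(_ p0 0).
  by rewrite !mxE !eqxx => /eqP; rewrite oner_eq0.
case/matrix0Pn=> a0 [c0]; rewrite mul_col_rowE mulf_eq0 negb_or.
case/andP=> u0a0 b0c0.
have [/'forall_'forall_'forall_'forall_eqP H|] := boolP [forall p : 'I_m,
    forall a, forall c, forall d,
    M (delta_mx p 0) a c * b0 0 d == M (delta_mx p 0) a d * b0 0 c].
  exists (\matrix_(a, p) (M (delta_mx p 0) a c0 / b0 0 c0)), b0 => z.
  apply/matrixP => a d; rewrite mul_col_rowE ent mxE mulr_suml.
  apply: eq_bigr => p _; rewrite mxE.
  transitivity (z p 0 * (M (delta_mx p 0) a c0 * b0 0 d / b0 0 c0)).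
    by rewrite H mulfK.
  by ring.
rewrite negb_forall => /existsP[p1]; rewrite negb_forall => /existsP[a].
rewrite negb_forall => /existsP[c]; rewrite negb_forall => /existsP[d].
set z1 : 'cV[F]_m := delta_mx p1 0 => ncd; exfalso.
have u0n0 : u0 != 0 by apply/matrix0Pn; exists a0, 0.
(* The rows of [M z1] are not all multiples of [b0], so its column direction must be that of
   [u0]. *)
have [b1 Mz1] : exists b1, M z1 = u0 *m b1.
  have [u1 [b1 Mz1]] := rank_le1P (M1 z1).
  have := M1 (z0 + z1); rewrite linearD Mz0 Mz1 => /rank_le1D uu.
  have [x y|z u1E] := parallel_colP u0n0 (v := u1).
    have /eqP := uu x y c d; rewrite mulf_eq0 => /orP[|]; rewrite subr_eq0.
      by move/eqP.
    move/eqP => e; move: ncd; rewrite Mz1 !mul_col_rowE -!mulrA.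
    by rewrite ![b1 0 _ * _]mulrC e eqxx.
  by exists (z *: b1); rewrite u1E -scalemxAl scalemxAr.
have b01 : b0 0 c * b1 0 d - b0 0 d * b1 0 c != 0.
  apply: contraNneq ncd => /eqP; rewrite subr_eq0 => /eqP e.
  by rewrite Mz1 !mul_col_rowE -!mulrA ![b1 0 _ * _]mulrC e.
(* A row direction cannot be parallel to both of the independent [b0] and [b1] unless it is zero, so
   every image has column direction [u0]. *)
have Mu0 z x y e : u0 x 0 * M z y e = u0 y 0 * M z x e.
  have [u [b Mz]] := rank_le1P (M1 z).
  have := M1 (z0 + z); rewrite linearD Mz0 Mz => /rank_le1D/(_ x y) h0.
  have := M1 (z1 + z); rewrite linearD Mz1 Mz => /rank_le1D/(_ x y) h1.
  rewrite !mul_col_rowE !mulrA; apply/eqP; rewrite -subr_eq0 -mulrBl mulf_eq0.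
  have [//|nz] := eqVneq (u0 x 0 * u y 0 - u0 y 0 * u x 0) 0.
  have par0 f g : b0 0 f * b 0 g = b0 0 g * b 0 f.
    by have /eqP := h0 f g; rewrite mulf_eq0 (negPf nz) subr_eq0 => /eqP.
  have par1 f g : b1 0 f * b 0 g = b1 0 g * b 0 f.
    by have /eqP := h1 f g; rewrite mulf_eq0 (negPf nz) subr_eq0 => /eqP.
  have : b 0 e * (b0 0 c * b1 0 d - b0 0 d * b1 0 c) = 0.
    transitivity ((b0 0 c * b 0 e) * b1 0 d - (b0 0 d * b 0 e) * b1 0 c).
      by ring.
    rewrite !(par0 _ e).
    transitivity (b0 0 e * (b1 0 d * b 0 c - b1 0 c * b 0 d)).
      by ring.
    by rewrite (par1 d c) subrr mulr0.
  by move/eqP; rewrite mulf_eq0 (negPf b01) orbF.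
(* Row [a0] now determines the whole image; as k < m, some nonzero vector is sent to zero. *)
pose K : 'M[F]_(m, k) := \matrix_(p, e) M (delta_mx p 0) a0 e.
have : kermx K != 0.
  rewrite kermx_eq0 /row_free neq_ltn; apply/orP; left.
  exact: leq_ltn_trans (rank_leq_col K) km.
case/rowV0Pn=> y /sub_kermxP yK; case/eqP.
have My : M y^T = 0.
  apply/matrixP => x e; rewrite mxE; apply/eqP.
  rewrite -(mulrI_eq0 _ (mulfI u0a0)) Mu0; apply/eqP.
  have /rowP/(_ e) := yK; rewrite !mxE => yKe.
  rewrite ent -[RHS](mulr0 (u0 x 0)).
  congr (_ * _); rewrite -[RHS]yKe; apply: eq_bigr => p _.
  by rewrite !mxE.
by rewrite -[y]trmxK (M_inj _ My) trmx0.
Qed.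

(** The vectors e_q kill the off-diagonal entries, and e_p + e_0 equates the diagonal ones. *)
Lemma scalar_mx_eigen n (C : 'M[F]_n) :
  (forall z : 'cV_n, exists x, C *m z = x *: z) -> exists x, C = x%:M.
Proof.
case: n C => [|n] C eig; first by exists 0; apply/matrixP => -[].
have Coff p q : p != q -> C p q = 0.
  move=> npq; have [x] := eig (delta_mx q 0); rewrite -colE => /colP/(_ p).
  by rewrite !mxE (negPf npq) mulr0.
exists (C 0 0); apply/matrixP => p q; rewrite mxE.
have [<-|/Coff //] := eqVneq p q; rewrite mulr1n.
have [<-//|n0p] := eqVneq 0 p.
have [x] := eig (delta_mx p 0 + delta_mx 0 0).
rewrite mulmxDr -!colE => /colP e; have := e p; have := e 0.
have np0 : p != 0 by rewrite eq_sym.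
rewrite !mxE !eqxx (negPf n0p) (negPf np0) (Coff _ _ n0p) (Coff _ _ np0).
by rewrite !add0r !addr0 !mulr1 => -> ->.
Qed.

Lemma inj_unitmx n (A : 'M[F]_n) :
  (forall z : 'cV_n, A *m z = 0 -> z = 0) -> A \in unitmx.
Proof.
move=> A_inj; rewrite -unitmx_tr -row_free_unit -kermx_eq0.
apply/rowV0P => v /sub_kermxP/(congr1 trmx).
by rewrite trmx_mul trmxK trmx0 => /A_inj/(congr1 trmx); rewrite trmxK trmx0.
Qed.

Lemma sum_col_delta m n (Z : 'M[F]_(m, n)) :
  Z = \sum_j col j Z *m delta_mx 0 j.
Proof.
apply/matrixP => a c; rewrite summxE (bigD1 c) //= big1 ?addr0 => [|j nj].
  by rewrite mul_col_rowE !mxE !eqxx mulr1.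
by rewrite mul_col_rowE !mxE (negPf (_ : c != j)) ?andbF ?mulr0 // eq_sym.
Qed.

(* As k < N, the images of the N-dimensional spaces of rank-one matrices with a
   given row space cannot lie in a space of matrices with a common column space;
   this excludes transposition. *)
Lemma rank_le1_preserver N k (L : {linear 'M[F]_(N, k) -> 'M[F]_(N, k)}) :
  (k < N)%N -> (forall Z, L Z = 0 -> Z = 0) ->
  (forall (z : 'cV_N) j, rank_le1 (L (z *m delta_mx 0 j))) ->
  (forall (z : 'cV_N) i j, i != j ->
     rank_le1 (L (z *m (delta_mx 0 i + delta_mx 0 j)))) ->
  exists A : 'M[F]_N, exists B : 'M[F]_k, forall Z, L Z = A *m Z *m B.
Proof.
move=> kN L_inj L1 L2.
have mul_delta_inj j (z : 'cV[F]_N) :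
    z *m delta_mx 0 j = 0 :> 'M_(N, k) -> z = 0.
  move=> e; apply/colP => x; have /matrixP/(_ x j) := e.
  by rewrite mul_col_rowE !mxE !eqxx mulr1.
(* On matrices supported in column [j], the map has the form z -> A_j z b_j. *)
have ex j : exists Ab : 'M[F]_N * 'rV[F]_k,
    forall z, L (z *m delta_mx 0 j) = Ab.1 *m z *m Ab.2.
  have [|z|A [b Ab]] := @rank_le1_space N N k
    (L \o mulmxr (delta_mx 0 j : 'rV_k)) kN.
  - by move=> z /= /L_inj/mul_delta_inj.
  - exact: L1.
  - by exists (A, b).
have [Ab LAb] := fin_all_exists ex; pose A j := (Ab j).1; pose b j := (Ab j).2.
have LE j z : L (z *m delta_mx 0 j) = A j *m z *m b j by exact: LAb.
have A_inj j (z : 'cV_N) : A j *m z = 0 -> z = 0.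
  by move=> Az; apply: (mul_delta_inj j); apply: L_inj; rewrite LE Az mul0mx.
have A_unit j : A j \in unitmx by apply: inj_unitmx => z; exact: A_inj.
pose x0 := Ordinal (leq_ltn_trans (leq0n k) kN).
pose e0 : 'cV[F]_N := delta_mx x0 0.
have z0n0 : e0 != 0.
  by apply/matrix0Pn; exists x0, 0; rewrite mxE !eqxx oner_eq0.
have b_n0 j : b j != 0.
  apply: contraNneq z0n0 => bj; apply/eqP.
  apply: (mul_delta_inj j); apply: L_inj.
  by rewrite LE bj mulmx0.
(* If b_j = x b_i, solving A_i z = x A_j e0 produces a nonzero matrix in the kernel of [L]. *)
have b_indep i j : i != j -> exists c, exists d,
    b i 0 c * b j 0 d - b i 0 d * b j 0 c != 0.
  move=> nij; have [/existsP[c /existsP[d cd]]|] := boolP [exists c, exists d,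
      b i 0 c * b j 0 d - b i 0 d * b j 0 c != 0]; first by exists c, d.
  rewrite negb_exists => /forallP H; exfalso.
  have [||x bj] := @parallel_colP k (b i)^T (b j)^T.
  - apply: contraNneq (b_n0 i) => /(congr1 trmx).
    by rewrite trmxK trmx0 => ->.
  - move=> c d; have := H c; rewrite negb_exists => /forallP/(_ d).
    by rewrite negbK subr_eq0 !mxE => /eqP.
  have {}bj : b j = x *: b i by rewrite -[b j]trmxK bj linearZ /= trmxK.
  pose z : 'cV[F]_N := invmx (A i) *m (x *: (A j *m e0)).
  have : L (z *m delta_mx 0 i + (- e0) *m delta_mx 0 j) = 0.
    rewrite linearD !LE mulKVmx // bj mulmxN mulNmx.
    by rewrite -scalemxAl -scalemxAr subrr.
  move/L_inj/matrixP/(_ x0 j); rewrite !mxE !big_ord1 !mxE !eqxx.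
  rewrite [j == i]eq_sym (negPf nij) mulr0 mulr1 add0r => /eqP.
  by rewrite oppr_eq0 oner_eq0.
(* A_i z b_i + A_j z b_j has rank at most one with b_i, b_j independent, so A_i z and A_j z are
   parallel for every z. *)
have A_prop i j : exists x, A j = x *: A i.
  have [->|nij] := eqVneq i j; first by exists 1; rewrite scale1r.
  have [c [d cd]] := b_indep i j nij.
  have [|x AA] := @scalar_mx_eigen _ (invmx (A i) *m A j).
    move=> z; have [->|zn0] := eqVneq z 0.
      by exists 0; rewrite mulmx0 scaler0.
    have [||x Az] := @parallel_colP _ (A i *m z) (A j *m z).
    - by apply: contraNneq zn0 => /A_inj->.
    - move=> p q; have := L2 z i j nij; rewrite mulmxDr linearD !LE.
      move/rank_le1D/(_ p q c d)/eqP; rewrite mulf_eq0 (negPf cd) orbF.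
      by rewrite subr_eq0 => /eqP.
    by exists x; rewrite -mulmxA Az -scalemxAr mulKmx.
  by exists x; rewrite -[A j](mulKVmx (A_unit i)) AA mul_mx_scalar.
case: (posnP k) => [k0|k_gt0].
  exists 0, 0 => Z; apply/matrixP => p q.
  by have := ltn_ord q; rewrite [X in (_ < X)%N]k0.
pose i0 := Ordinal k_gt0.
have [x Ax] := fin_all_exists (A_prop i0).
exists (A i0), (\matrix_j (x j *: b j)) => Z.
rewrite [Z in RHS]sum_col_delta {1}[Z]sum_col_delta.
rewrite raddf_sum mulmx_sumr mulmx_suml.
apply: eq_bigr => j _ /=; rewrite LE mulmxA -[RHS]mulmxA -rowE rowK.
by rewrite Ax -scalemxAr -!scalemxAl.
Qed.

End RankOne.

(** * Directions along which the determinant is affine *)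

(** The double negation keeps this constructive and suffices for deriving a contradiction. *)
Lemma uniq_seq_of_infinite (F : fieldType) m :
  ~ (exists e : seq F, Finite.axiom e) ->
  ~ ~ (exists2 e : seq F, uniq e & size e = m).
Proof.
move=> Finf; elim: m => [|m IH]; first by apply; exists [::].
move=> no; apply: IH => -[e ue se]; apply: Finf; exists e => x.
rewrite count_uniq_mem //; case: (boolP (x \in e)) => // xe.
by case: no; exists (x :: e); rewrite /= ?xe ?se.
Qed.

Lemma poly_fun_eq0 (F : fieldType) k (p : {poly F}) :
  card_field_gt F k -> (size p <= k.+1)%N -> (forall t, p.[t] = 0) -> p = 0.
Proof.
move=> hF sp p0; apply/eqP; apply: contraT => pn0.
have max (e : seq F) : uniq e -> (size e <= k)%N.
  move=> ue; rewrite -ltnS; apply: leq_trans sp.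
  by apply: max_poly_roots ue => //; apply/allP => t _; apply/eqP.
case: hF => [Finf|[e [fe se]]].
  exfalso; apply: (uniq_seq_of_infinite (m := k.+1) Finf) => -[e /max].
  by move=> H se; rewrite se ltnn in H.
have ue : uniq e.
  apply: count_mem_uniq => x; rewrite fe (_ : x \in e) //.
  by rewrite -has_pred1 has_count fe.
by have := max e ue; rewrite leqNgt se.
Qed.

Section Affine.
Variables (F : fieldType) (n k : nat).
Implicit Types X Y : 'M[F]_(n, k).

(** The slope is read off at t = 1. *)
Definition affine_dir Y := forall X t,
  cullis_det (X + t *: Y) =
  cullis_det X + t * (cullis_det (X + Y) - cullis_det X).

Lemma affine_dir_delta (z : 'cV[F]_n) (j : 'I_k) :
  affine_dir (z *m delta_mx 0 j).
Proof.
by move=> X t; rewrite scalemxAl !cullis_addcol cullis_setcolZ; ring.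
Qed.

Lemma affine_dir_mulr Y (B : 'M[F]_k) :
  B \in unitmx -> affine_dir Y -> affine_dir (Y *m B).
Proof.
move=> uB aY X t; rewrite -[X](mulmxKV uB) scalemxAl -!mulmxDl.
by move: (X *m _) => {}X; rewrite !cullis_mulmxr aY; ring.
Qed.

Lemma affine_dir_delta2 (z : 'cV[F]_n) (i j : 'I_k) : i != j ->
  affine_dir (z *m (delta_mx 0 i + delta_mx 0 j)).
Proof.
(* This column operation turns e_i into e_i + e_j and so reduces to a single column. *)
move=> nij; pose B : 'M[F]_k := 1%:M + delta_mx i j.
have uB : B \in unitmx.
  suff /mulmx1_unit[] : B *m (1%:M - delta_mx i j) = 1%:M by [].
  rewrite mulmxDl !mulmxBr !mul1mx !mulmx1 mul_delta_mx_0 1?eq_sym //.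
  by rewrite subr0 subrK.
have -> : delta_mx 0 i + delta_mx 0 j = delta_mx 0 i *m B :> 'rV_k.
  by rewrite mulmxDr mulmx1 mul_delta_mx.
by rewrite mulmxA; apply/affine_dir_mulr/affine_dir_delta.
Qed.

(* With the columns b and c of X zeroed, the polynomial t |-> det (X + t Y) is
   divisible by t ^ 2, and the quotient takes the required value at 0. *)
Lemma affine_dir_cols Y (b c : 'I_k) : card_field_gt F k -> b != c ->
  affine_dir Y ->
  forall X, col b X = col b Y -> col c X = col c Y -> cullis_det X = 0.
Proof.
move=> hF nbc aY X Xb Xc.
pose X0 := setcol (setcol X b 0) c 0.
pose g (s : {ffun 'I_k -> 'I_n}) a : {poly F} :=
  (X0 (s a) a)%:P + Y (s a) a *: 'X.
pose p := \sum_(s : {ffun 'I_k -> 'I_n}) eps F s *: \prod_a g s a.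
pose q := \sum_(s : {ffun 'I_k -> 'I_n}) eps F s *:
  ((Y (s b) b * Y (s c) c) *: \prod_(a | (a != b) && (a != c)) g s a).
have pE t : p.[t] = cullis_det (X0 + t *: Y).
  rewrite cullis_detE horner_sum; apply: eq_bigr => s _.
  rewrite hornerZ horner_prod; congr (_ * _); apply: eq_bigr => a _.
  by rewrite !hornerE !mxE mulrC.
have size_p : (size p <= k.+1)%N.
  apply: leq_trans (size_sum _ _ _) _; apply/bigmax_leqP => s _.
  apply: leq_trans (size_scale_leq _ _) _.
  apply: leq_trans (size_prod_leq _ _) _.
  have : (\sum_(a < k) size (g s a) <= \sum_(a < k) 2)%N.
    apply: leq_sum => a _; apply: leq_trans (size_polyD _ _) _.
    rewrite geq_max (leq_trans (size_polyC_leq1 _)) //=.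
    by apply: leq_trans (size_scale_leq _ _) _; rewrite size_polyX.
  rewrite sum_nat_const card_ord; set S := (\sum_i _)%N => Sk.
  by lia.
have pq : p = q * 'X^2.
  rewrite mulr_suml; apply: eq_bigr => s _.
  rewrite (bigD1 b) //= (bigD1 c) 1?eq_sym //= /g !mxE !eqxx (negPf nbc).
  by rewrite !polyC0 !add0r -!mul_polyC polyCM; ring.
have k_gt0 : (0 < k)%N by apply: leq_ltn_trans (ltn_ord b).
(* A polynomial of degree at most k which vanishes on all of [F], by affineness. *)
have : p - ((cullis_det X0)%:P +
            (cullis_det (X0 + Y) - cullis_det X0) *: 'X) = 0.
  apply: (poly_fun_eq0 hF) => [|t]; last first.
    by rewrite !hornerE pE aY; ring.
  apply: leq_trans (size_polyD _ _) _; rewrite geq_max size_p size_polyN /=.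
  apply: leq_trans (size_polyD _ _) _.
  rewrite geq_max (leq_trans (size_polyC_leq1 _)) //=.
  by apply: leq_trans (size_scale_leq _ _) _; rewrite size_polyX.
(* The coefficient of degree 2 is q(0), which is the determinant of [X]. *)
move/(congr1 (fun r : {poly F} => r`_2)); 
rewrite pq coefB coefMXn coefD coefC coefZ coefX coef0 /= mulr0 addr0 subr0.
rewrite -horner_coef0 => <-; rewrite horner_sum cullis_detE.
apply: eq_bigr => s _; rewrite !hornerZ horner_prod; congr (_ * _).
rewrite (bigD1 b) //= (bigD1 c) 1?eq_sym //= [LHS]mulrA; congr (_ * _ * _).
- by have /colP/(_ (s b)) := Xb; rewrite !mxE.
- by have /colP/(_ (s c)) := Xc; rewrite !mxE.
apply: eq_bigr => a /andP[/negPf ab /negPf ac].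
by rewrite !hornerE !mxE ab ac.
Qed.

End Affine.

(** * The quotient by W *)

Section Differences.
Variables (F : fieldType) (N k : nat).
Implicit Types X Y : 'M[F]_(N.+1, k).

(* [diffmx *m X] subtracts the first row of X from all the others; its kernel is
   W, so that it identifies the quotient by W with N x k matrices, and [addmx0]
   is a section of it. *)
Definition diffmx : 'M[F]_(N, N.+1) :=
  \matrix_(a, x) ((x == lift 0 a)%:R - (x == 0)%:R).

Definition addmx0 : 'M[F]_(N.+1, N) := \matrix_(x, a) (x == lift 0 a)%:R.

Lemma diffmxE X a c : (diffmx *m X) a c = X (lift 0 a) c - X 0 c.
Proof.
rewrite mxE; under eq_bigr do rewrite mxE mulrBl.
rewrite big_split sumrN /=; congr (_ - _).
  rewrite (bigD1 (lift 0 a)) //= eqxx mul1r big1 ?addr0 //.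
  by move=> x /negPf->; rewrite mul0r.
rewrite (bigD1 0) //= mul1r big1 ?addr0 //.
by move=> x /negPf->; rewrite mul0r.
Qed.

Lemma addmx0E m (Z : 'M[F]_(N, m)) x c :
  (addmx0 *m Z) x c = if unlift 0 x is Some a then Z a c else 0.
Proof.
rewrite mxE; case: unliftP => [a ->|->].
  rewrite (bigD1 a) //= mxE eqxx mul1r big1 ?addr0 // => b nab.
  by rewrite mxE (inj_eq lift_inj) eq_sym (negPf nab) mul0r.
by apply: big1 => b _; rewrite mxE mul0r.
Qed.

Lemma diffmxK (Z : 'M[F]_(N, k)) : diffmx *m (addmx0 *m Z) = Z.
Proof.
by apply/matrixP => a c; rewrite diffmxE !addmx0E liftK unlift_none subr0.
Qed.

Lemma addmx0_diffmx X :
  X = addmx0 *m (diffmx *m X) + const_mx 1 *m row 0 X.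
Proof.
apply/matrixP => x c; rewrite [RHS]mxE addmx0E mul_col_rowE.
rewrite [const_mx _ _ _]mxE [row _ _ _ _]mxE mul1r.
by case: unliftP => [a ->|->]; rewrite ?add0r // diffmxE subrK.
Qed.

Lemma diffmx_eq0P Y : reflect (diffmx *m Y = 0) (Y \in equal_rows).
Proof.
apply: (iffP idP) => [|Y0].
  rewrite inE => /forallP/(_ 0)/forallP rY; apply/matrixP => a c.
  rewrite diffmxE mxE; have /eqP/rowP/(_ c) := rY (lift 0 a).
  by rewrite !mxE => ->; rewrite subrr.
rewrite inE; apply/forallP => x; apply/forallP => y; apply/eqP/rowP => c.
by rewrite [Y]addmx0_diffmx Y0 mulmx0 add0r !mxE !big_ord1 !mxE.
Qed.

Hypothesis odd_nk : odd (N.+1 + k).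

Lemma cullis_add_ones X (u : 'rV[F]_k) :
  cullis_det (X + const_mx 1 *m u) = cullis_det X.
Proof.
rewrite [const_mx 1 *m u]sum_col_delta; elim: (index_enum _) X => [|j r IH] X.
  by rewrite big_nil addr0.
rewrite big_cons addrA IH cullis_addcol.
have -> : col j (const_mx 1 *m u) = u 0 j *: const_mx 1 :> 'cV_N.+1.
  by apply/colP => x; rewrite mxE mul_col_rowE !mxE mulrC.
rewrite cullis_setcolZ [X in _ * X](@cullis_ones _ _ _ _ j odd_nk).
  by rewrite mulr0 addr0.
by apply/colP => x; rewrite !mxE eqxx.
Qed.

Lemma cullis_add_W X Y : diffmx *m Y = 0 -> cullis_det (X + Y) = cullis_det X.
Proof.
by move=> Y0; rewrite [Y]addmx0_diffmx Y0 mulmx0 add0r cullis_add_ones.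
Qed.

Hypotheses (k_ge4 : (4 <= k)%N) (kN : (k < N)%N).

(** If X shares column [j] with Y, then X - Y can be replaced by a matrix with zero column [j], so
    det X = 0. Column [j] of Y is thus parallel, modulo the all-ones vector, to any other vector. *)
Lemma cullis_radical Y :
  (forall X, cullis_det (X + Y) = cullis_det X) -> diffmx *m Y = 0.
Proof.
move=> radY; apply/matrixP => a j; rewrite diffmxE [RHS]mxE.
have col0 X : col j X = col j Y -> cullis_det X = 0.
  move=> Xj; pose X1 := setcol X j 0 - setcol Y j 0.
  have -> : X = X1 + Y.
    apply/matrixP => x c; rewrite !mxE.
    case: eqP => [->|_]; last by rewrite subrK.
    by rewrite subrr add0r; have /colP/(_ x) := Xj; rewrite !mxE.
  rewrite radY -(setcol_id X1 j) (_ : col j X1 = 0 *: 0).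
    by rewrite cullis_setcolZ mul0r.
  by apply/colP => x; rewrite !mxE eqxx subrr mul0r.
have [i nij] : exists i : 'I_k, j != i.
  have [e|] := eqVneq j (Ordinal (ltn_trans (isT : 0 < 3)%N k_ge4)).
    exists (Ordinal (ltn_trans (isT : 1 < 3)%N k_ge4)).
    by rewrite e -val_eqE.
  by eexists; eassumption.
have [q nqa] : exists q : 'I_N, a != q.
  have N1 : (1 < N)%N by lia.
  have [e|] := eqVneq a (Ordinal (ltnW N1)); last by eexists; eassumption.
  by exists (Ordinal N1); rewrite e -val_eqE.
(* The test vector is a basis vector at a row other than 0 and the row of [a]. *)
have := cullis_pair_parallel k_ge4 (ltnW kN) nij
  (v := col j Y) (w := delta_mx (lift 0 q) 0) (fun X Xj _ => col0 X Xj).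
move=> /(_ (lift 0 a) (lift 0 q)); rewrite !mxE !eqxx (inj_eq lift_inj).
by rewrite (negPf nqa) subr0 mulr1 subrr mulr0.
Qed.

Lemma affine_dir_rank_le1 Y :
  card_field_gt F k -> affine_dir Y -> rank_le1 (diffmx *m Y).
Proof.
move=> hF aY a b c d; have [->|ncd] := eqVneq c d; first by rewrite mulrC.
have := cullis_pair_parallel k_ge4 (ltnW kN) ncd (affine_dir_cols hF ncd aY).
move=> /(_ (lift 0 a) (lift 0 b)).
by rewrite !diffmxE !mxE => ->; rewrite mulrC.
Qed.

Lemma cullis_preserver_form (T : {linear 'M[F]_(N.+1, k) -> 'M[F]_(N.+1, k)}) :
  card_field_gt F k ->
  (forall X, cullis_det (T X) = cullis_det X) ->
  exists A : 'M[F]_N.+1, exists B : 'M[F]_k,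
    forall X, diffmx *m (T X - A *m X *m B) = 0.
Proof.
move=> hF detT.
pose Tb : {linear 'M[F]_(N, k) -> 'M[F]_(N, k)} :=
  mulmx diffmx \o T \o mulmx addmx0.
have TbE Z : Tb Z = diffmx *m T (addmx0 *m Z) by [].
have Tb_inj Z : Tb Z = 0 -> Z = 0.
  move=> TbZ; rewrite -[Z]diffmxK; apply: cullis_radical => X.
  by rewrite -detT linearD cullis_add_W // detT.
(* Injectivity gives surjectivity in finite dimension, so [T] is onto modulo W. *)
have Tb_surj Z : exists Z', Tb Z' = Z.
  have k0 : lker (linfun Tb) == 0%VS.
    apply/lker0P => Z1 Z2; rewrite !lfunE => e; apply/eqP.
    by rewrite -subr_eq0; apply/eqP/Tb_inj; rewrite linearB e subrr.
  by exists ((linfun Tb)^-1%VF Z); rewrite -[LHS]lfunE lker0_lfunVK.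
have T_onto X : exists X', exists2 D, diffmx *m D = 0 & X = T X' + D.
  have [Z TbZ] := Tb_surj (diffmx *m X).
  exists (addmx0 *m Z), (X - T (addmx0 *m Z)); last by rewrite addrC subrK.
  by rewrite mulmxBr -TbE TbZ subrr.
(* W is the radical, which a preserver onto modulo W maps into itself; likewise for affine
   directions below. *)
have T_W Y : diffmx *m Y = 0 -> diffmx *m T Y = 0.
  move=> Y0; apply: cullis_radical => X.
  have [X' [D D0 ->]] := T_onto X.
  rewrite addrAC -linearD (cullis_add_W _ D0) detT.
  by rewrite (cullis_add_W _ Y0) (cullis_add_W _ D0) detT.
have T_affine Y : affine_dir Y -> affine_dir (T Y).
  move=> aY X t; have [X' [D D0 ->]] := T_onto X.
  rewrite !(addrAC _ D) -linearZ -!linearD !(cullis_add_W _ D0) !detT.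
  exact: aY.
have [z j|z i j nij|A [B AB]] := @rank_le1_preserver F N k Tb kN Tb_inj.
- rewrite TbE; apply: affine_dir_rank_le1 => //; apply: T_affine.
  by rewrite mulmxA; apply: affine_dir_delta.
- rewrite TbE; apply: affine_dir_rank_le1 => //; apply: T_affine.
  by rewrite mulmxA; apply: affine_dir_delta2.
(* The matrix found on the quotient is lifted through the section [addmx0]. *)
exists (addmx0 *m A *m diffmx), B => X.
rewrite mulmxBr -!mulmxA diffmxK {1}[X]addmx0_diffmx linearD mulmxDr.
rewrite [X in _ + X - _]T_W; last first.
  by apply/matrixP => a c; rewrite diffmxE !mxE !big_ord1 !mxE subrr.
by rewrite addr0 -TbE AB -!mulmxA subrr.
Qed.

End Differences.

(** * Increasing column selections and the equivalence *)

Lemma cullis_det_delta (F : fieldType) n k (i : 'I_k -> 'I_n) :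
  cullis_det (colsub i 1%:M : 'M[F]_(n, k)) = eps F i.
Proof.
rewrite cullis_detE (bigD1 [ffun a => i a]) //=.
rewrite [X in eps F _ * X]big1 => [|a _]; last by rewrite !mxE ffunE eqxx.
rewrite mulr1 big1 ?addr0 => [|s nsi].
  by apply: eq_eps => a; rewrite ffunE.
have [a sa] : exists a, s a != i a.
  apply/existsP; apply: contraNT nsi; rewrite negb_exists => /forallP H.
  by apply/eqP/ffunP => a; rewrite ffunE; apply/eqP; rewrite -[_ == _]negbK.
by rewrite (bigD1 a) //= !mxE (negPf sa) mul0r mulr0.
Qed.

Lemma eps_incr_shift (F : fieldType) n k (i : 'I_k -> 'I_n) :
  (forall a b : 'I_k, (a < b)%N -> (i a < i b)%N) ->
  eps F i = (-1) ^+ (\sum_(a < k) (i a).+1 - \sum_(a < k) a.+1)%N.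
Proof.
move=> i_incr; rewrite eps_incr // -sumnB => [|a _]; last first.
  by rewrite ltnS incr_ord_ge.
by congr (_ ^+ _); apply: eq_bigr => a _; rewrite subSS.
Qed.

(** Alternation extends the hypothesis from increasing selections to all functions, which is what
    the expansion of det (A X) requires. *)
Lemma cullis_mulmxl_scale (F : fieldType) n k (A : 'M[F]_n) (x : F) :
  (forall i : 'I_k -> 'I_n, (forall a b : 'I_k, (a < b)%N -> (i a < i b)%N) ->
     cullis_det (colsub i A) * x = eps F i) ->
  forall X : 'M[F]_(n, k), cullis_det (A *m X) * x = cullis_det X.
Proof.
move=> Ax X; rewrite cullis_mulmxl mulr_suml cullis_detE.
apply: eq_bigr => s _; rewrite -mulrA mulrC; congr (_ * _).
have [s_inj|/injectivePn[a [b nab sab]]] := boolP (injectiveb s); last first.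
  by rewrite (cullis_colsub_noninj _ nab sab) mul0r (eps_noninj _ nab sab).
have [t st] := inj_index_perm (Sub s s_inj : injection k n).
rewrite (eq_eps _ st) eps_perm -Ax; last exact: inj_index_mono.
rewrite mulrA -cullis_colsub_perm; congr (cullis_det _ * _).
by apply/matrixP => y a; rewrite !mxE -st.
Qed.

Theorem theorem4p12 (F : fieldType) (n k : nat)
    (hF : card_field_gt F k) (hk : (4 <= k)%N) (hn : (k + 2 <= n)%N)
    (hodd : odd (n + k))
    (T : {linear 'M[F]_(n, k) -> 'M[F]_(n, k)}) :
  (forall X : 'M[F]_(n, k), cullis_det (T X) = cullis_det X) <->
  (exists (A : 'M[F]_n) (B : 'M[F]_k),
     (forall i : 'I_k -> 'I_n,
        (forall a b : 'I_k, (a < b)%N -> (i a < i b)%N) ->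
        cullis_det (colsub i A) * \det B =
        (-1) ^+ (\sum_(a < k) (i a).+1 - \sum_(a < k) a.+1)%N) /\
     (exists phi : {linear 'M[F]_(n, k) -> 'M[F]_(n, k)},
        (forall X : 'M[F]_(n, k), phi X \in equal_rows) /\
        (forall X : 'M[F]_(n, k), T X = A *m X *m B + phi X))).
Proof.
case: n hn hodd T => [|N] hn hodd T; first by lia.
have kN : (k < N)%N by lia.
split=> [detT|[A [B [detAB [phi [phiW TE]]]]] X]; last first.
  rewrite TE cullis_add_W ?cullis_mulmxr //; last exact/diffmx_eq0P.
  by apply: cullis_mulmxl_scale => i i_incr; rewrite detAB ?eps_incr_shift.
have [A [B phiW]] := cullis_preserver_form hodd hk kN hF detT.
exists A, B; split=> [i i_incr|]; last first.
  exists (T \- (mulmxr B \o mulmx A)); split=> X.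
    exact/diffmx_eq0P/phiW.
  by rewrite /= addrC subrK.
(* The condition on A and B is the preservation of det at the matrix with columns e_(i a), which A
   maps to its selected columns. *)
rewrite -eps_incr_shift // -cullis_det_delta -[RHS]detT -cullis_mulmxr.
set X : 'M[F]_(N.+1, k) := colsub i 1%:M.
rewrite -[T X](subrK (A *m X *m B)) addrC cullis_add_W //.
by congr (cullis_det (_ *m _)); rewrite mulmx_colsub mulmx1.
Qed.
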